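(* Let $d\ge 2$, let $\mathbf{p}=(p_1,\dots,p_d)$ with integers $p_1,\dots,p_d\ge 2$, let $\Omega\subseteq\{0,1,\dots,r-1\}^{\mathbb{N}}$ be a subshift, and let $X^{\mathbf{p}}_\Omega$ be the associated 2-multiplicative integer system on $\mathbb{N}^d$. For every $h\in\left[h(X^{\mathbf{p}}_\Omega),\log|\Omega_1|\right]$ there is a real number $\tau$ such that $h$ is realized as a boundary complexity with speed $\tau$; that is, there are a $\tau$ and a $d$-tuple of functions $\mathbf{f}=(f_1,\dots,f_d)$ with $\lim_{n_1,\dots,n_d\to\infty}\frac{f_1(n_1)\cdots f_d(n_d)}{n_1\cdots n_d}=\tau$ such that $h^{\mathbf{f}}(X^{\mathbf{p}}_\Omega)=h$.
   Context: $\mathbb{N}=\{1,2,\dots\}$; products $\mathbf{i}\cdot\mathbf{p}^\ell=(i_1p_1^\ell,\dots,i_dp_d^\ell)$ are coordinatewise. The 2-multiplicative integer system is $X^{\mathbf{p}}_\Omega=\{(x_{\mathbf{i}})_{\mathbf{i}\in\mathbb{N}^d}\in\{0,\dots,r-1\}^{\mathbb{N}^d}: (x_{\mathbf{i}\cdot\mathbf{p}^\ell})_{\ell=0}^\infty\in\Omega\text{ for all }\mathbf{i}\in\mathbb{N}^d\}$. $\Omega_\ell$ denotes the set of admissible blocks of length $\ell$ of $\Omega$. For a finite $F\subset\mathbb{N}^d$, $\mathcal{P}(F,X)=\{(x_{\mathbf{i}})_{\mathbf{i}\in F}:x\in X\}$. For $d$ functions $f_1,\dots,f_d$ on $\mathbb{N}$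 with values in the nonnegative integers and $\mathbf{m}=(m_1,\dots,m_d)\in\mathbb{N}^d$, let $F_{\mathbf{m}}(\mathbf{f})=\prod_{j=1}^d\{1,\dots,m_j\}\setminus\prod_{j=1}^d\{1,\dots,f_j(m_j)\}$; the boundary complexity is $h^{\mathbf{f}}(X)=\lim_{\mathbf{m}\to\infty}\frac{\log|\mathcal{P}(F_{\mathbf{m}}(\mathbf{f}),X)|}{|F_{\mathbf{m}}(\mathbf{f})|}$ whenever the limit exists, where $\mathbf{m}\to\infty$ means $m_j\to\infty$ for all $j$. The topological entropy is $h(X)=\lim_{\mathbf{m}\to\infty}\frac{1}{m_1\cdots m_d}\log|\mathcal{P}(\prod_{j=1}^d\{1,\dots,m_j\},X)|$. *)

(* Defs.v *)
From HB Require Import structures.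
From mathcomp Require Import all_boot all_order all_algebra finmap.
From mathcomp Require Import all_classical all_reals all_analysis.

Set Implicit Arguments.
Unset Strict Implicit.
Unset Printing Implicit Defensive.

Import Order.TTheory GRing.Theory Num.Theory numFieldNormedType.Exports.

Local Open Scope classical_set_scope.
Local Open Scope ring_scope.

(* N^d with N = {1, 2, ...}; all coordinates are positive. *)
Record posvec (d : nat) := Posvec {
  coord :> {ffun 'I_d -> nat};
  _ : [forall j, (0 < coord j)%N] }.

HB.instance Definition _ d := [isSub for @coord d].
HB.instance Definition _ d := [Choice of posvec d by <:].

Lemma posvec_gt0 d (i : posvec d) j : (0 < i j)%N.
Proof. by case: i => i /= /forallP. Qed.

Lemma dilate_subproof d (i p : posvec d) (l : nat) :
  [forall j, (0 < [ffun j => i j * p j ^ l] j)%N].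
Proof.
by apply/forallP => j; rewrite ffunE muln_gt0 expn_gt0 !posvec_gt0.
Qed.

(* i . p^l = (i_1 p_1^l, ..., i_d p_d^l) *)
Definition dilate d (i p : posvec d) (l : nat) : posvec d :=
  Posvec (dilate_subproof i p l).

Definition seq_shift (A : Type) (x : nat -> A) : nat -> A := fun n => x n.+1.

(* One-sided sequences are indexed from 0.  Shift invariance is the equality
   of Omega with its image under the shift: the mere inclusion would allow
   symbols that occur only at position 0. *)
Definition subshift (r : nat) (Omega : set (nat -> 'I_r)) : Prop :=
  [/\ Omega !=set0,
      closed (Omega : set (prod_topology (fun _ : nat => discrete_topology 'I_r)))
    & @seq_shift 'I_r @` Omega = Omega].

Definition blocks (r : nat) (Omega : set (nat -> 'I_r)) (l : nat) :
    {set l.-tuple 'I_r} :=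
  [set w : l.-tuple 'I_r |
    `[< exists2 x, Omega x & exists k, forall i : 'I_l, x (k + i)%N = tnth w i >]]%SET.

(* The 2-multiplicative integer system X_Omega^p on N^d. *)
Definition mis (d r : nat) (p : posvec d) (Omega : set (nat -> 'I_r)) :
    set (posvec d -> 'I_r) :=
  [set x | forall i : posvec d, Omega (fun l => x (dilate i p l))].

Definition patterns (d r : nat) (F : {fset posvec d}) (X : set (posvec d -> 'I_r)) :
    {set {ffun F -> 'I_r}} :=
  [set w : {ffun F -> 'I_r} |
    `[< exists2 x, X x & forall i : F, w i = x (val i) >]]%SET.

(* fset_set sends infinite sets to fset0; see box_finite and in_box. *)
Definition box (d : nat) (n : 'I_d -> nat) : {fset posvec d} :=
  fset_set [set i : posvec d | forall j, (i j <= n j)%N].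

Lemma box_finite d (n : 'I_d -> nat) :
  finite_set [set i : posvec d | forall j, (i j <= n j)%N].
Proof.
pose N := (\max_j n j)%N.
pose D := [set i : posvec d | forall j, (i j <= n j)%N].
pose g (i : posvec d) : {ffun 'I_d -> 'I_N.+1} := [ffun j => inord (i j)].
have g_inj : {in D &, injective g}.
  move=> x y; rewrite !inE => Dx Dy /ffunP gxy; apply/val_inj/ffunP => j.
  have bnd (i : posvec d) : D i -> (i j < N.+1)%N.
    by move=> Di; rewrite ltnS (leq_trans (Di j))// leq_bigmax.
  by move: (gxy j) => /(congr1 val); rewrite !ffunE /= !inordK ?bnd.
by rewrite -/D -(eq_finite_set (inj_card_eq g_inj)); exact: finite_finset.
Qed.

Lemma in_box d (n : 'I_d -> nat) (i : posvec d) :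
  (i \in box n) = [forall j, (i j <= n j)%N].
Proof.
rewrite in_fset_set; last exact: box_finite.
by apply/idP/forallP; rewrite inE.
Qed.

(* F_m(f) *)
Definition boundary (d : nat) (f : 'I_d -> nat -> nat) (m : 'I_d -> nat) :
    {fset posvec d} :=
  (box m `\` box (fun j => f j (m j)))%fset.

(* m --> infinity in N^d: every coordinate of m tends to infinity. *)
Definition to_infty (d : nat) : set_system ('I_d -> nat) :=
  filter_from setT (fun N : nat => [set m | forall j, (N <= m j)%N]).

Arguments to_infty : clear implicits.

#[global] Instance to_infty_properfilter d : ProperFilter (to_infty d).
Proof.
apply: filter_from_proper; last by move=> N _; exists (fun=> N) => j /=.
apply: filter_from_filter; first by exists 0%N.
move=> M N _ _; exists (maxn M N) => // m mMN.
by split=> j; have := mMN j; rewrite geq_max => /andP[].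
Qed.

Definition entropy (R : realType) (d r : nat) (X : set (posvec d -> 'I_r)) : R :=
  lim ((fun m : 'I_d -> nat =>
          ln (#|patterns (box m) X|%:R : R) / (\prod_j m j)%:R) @ to_infty d).

(* h^f(X) exists and equals h; since x / 0 = 0 in R, the quotients are required
   to have nonzero denominator eventually. *)
Definition has_boundary_complexity (R : realType) (d r : nat)
    (f : 'I_d -> nat -> nat) (X : set (posvec d -> 'I_r)) (h : R) : Prop :=
  (\forall m \near to_infty d, boundary f m != fset0) /\
  (fun m : 'I_d -> nat =>
     ln (#|patterns (boundary f m) X|%:R : R) / (#|` boundary f m|)%:R)
    @ to_infty d --> h.

Definition has_speed (R : realType) (d : nat) (f : 'I_d -> nat -> nat) (tau : R) :
    Prop :=
  (fun m : 'I_d -> nat => (\prod_j f j (m j))%:R / (\prod_j m j)%:R : R)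
    @ to_infty d --> tau.

(* Main.v *)
(** Split [N^d] into the chains [i, i p, i p^2, ...].  Membership in [mis p Omega]
    constrains each chain separately, so the number of patterns on a set [F]
    whose intersection with every chain is an interval is the product over the
    chains of the numbers of blocks of [Omega] of the corresponding lengths.
    Adding to [F] a point [i] that precedes [k - 1] consecutive points of [F] on
    its chain therefore increases the logarithm by
    [D k = ln |Omega_k| - ln |Omega_(k-1)|].  Writing [D k] as the sum of its
    increments [e l] for [l < k], where [e 0 = ln |Omega_1|], the logarithm for
    [F_m(f)] is [sum_l e l * #{i in F_m(f) | i p^l in box m}].

    For [f_j(n) = floor (t n)] and [0 <= t <= 1], dividing by [m_1 ... m_d] and
    letting [m] tend to infinity gives
    [S t = sum_l e l * (prod_j p_j^(-l) - prod_j min (p_j^(-l), t))],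
    where the term of index 0 is [e 0] times the limit density [b t = 1 - t^d] of [F_m(f)].
    At [t = 0] the ratio [S t / b t] is the entropy; at [t = 1/2] all terms
    with [l > 0] vanish and the ratio is [ln |Omega_1|].  The intermediate
    value theorem applied to [S - h b] gives the required [t]. *)
Require Import Defs.
From mathcomp Require Import all_boot all_order all_algebra finmap.
From mathcomp Require Import all_classical all_reals all_analysis.
From mathcomp Require Import lra.
Import Order.TTheory GRing.Theory Num.Theory numFieldNormedType.Exports.
Local Open Scope classical_set_scope.
Local Open Scope ring_scope.

Set Implicit Arguments.
Unset Strict Implicit.
Unset Printing Implicit Defensive.

(** * Cardinalities of images in finite types *)

Section ImageCard.
Variables (U : Type) (S : set U).

(** Both [patterns] and [blocks] are images of this kind, so their sizes can be compared through the
    configurations or sequences that induce them. *)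
Definition fin_image (A : finType) (f : U -> A) : {set A} :=
  [set a | `[< exists2 x, S x & f x = a >]]%SET.

Lemma leq_card_fin_image (A B : finType) (f : U -> A) (g : U -> B) :
  (forall x y, S x -> S y -> g x = g y -> f x = f y) ->
  (#|fin_image f| <= #|fin_image g|)%N.
Proof.
move=> gf; rewrite -(card_imset _ (@set1_inj A)).
(* [fiber b] collects the values of [f] over the [g]-fibre of [b]. For [b] in the image of [g] it is
   a singleton, and every [[set a]] with [a] a value of [f] arises in this way. *)
pose fiber b := [set a | `[< exists2 x, S x & f x = a /\ g x = b >]]%SET.
apply: leq_trans (leq_imset_card fiber (fin_image g)).
apply/subset_leq_card/fintype.subsetP => _ /imsetP[a + ->]; rewrite inE => /asboolP[x Sx fx].
apply/imsetP; exists (g x); first by rewrite inE; apply/asboolP; exists x.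
apply/setP => c; rewrite !inE; apply/eqP/asboolP => [-> | [y Sy [<- gyx]]].
  by exists x.
by rewrite -fx; apply: gf.
Qed.

Lemma eq_card_fin_image (A B : finType) (f : U -> A) (g : U -> B) :
  (forall x y, S x -> S y -> f x = f y <-> g x = g y) ->
  #|fin_image f| = #|fin_image g|.
Proof.
move=> fg; apply/eqP; rewrite eqn_leq.
by apply/andP; split; apply: leq_card_fin_image => x y Sx Sy /(fg x y Sx Sy).
Qed.

(** Splicing makes every pair of values attainable, so the joint image is a full product. *)
Lemma card_fin_image_pair (A B : finType) (f : U -> A) (g : U -> B) :
  (forall x y, S x -> S y -> exists2 z, S z & f z = f x /\ g z = g y) ->
  #|fin_image (fun x => (f x, g x))| = (#|fin_image f| * #|fin_image g|)%N.
Proof.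
move=> splice; rewrite -cardsX; congr #|pred_of_set _|.
apply/setP => -[a b]; rewrite !inE /=; apply/asboolP/andP.
  by move=> [x Sx [<- <-]]; split; apply/asboolP; exists x.
move=> [/asboolP[x Sx <-] /asboolP[y Sy <-]].
by have [z Sz [fz gz]] := splice x y Sx Sy; exists z; rewrite ?fz ?gz.
Qed.

End ImageCard.

(** * Patterns on chains *)

Section Patterns.
Variables (d r : nat) (p : posvec d) (Omega : set (nat -> 'I_r)).
Hypotheses (d_gt0 : (0 < d)%N) (p_ge2 : forall j, (2 <= p j)%N).
Hypothesis shiftOmega : @seq_shift 'I_r @` Omega = Omega.

Local Notation X := (mis p Omega).
Local Open Scope fset_scope.
Local Open Scope nat_scope.

Lemma posvecP (i j : posvec d) : (forall k, i k = j k) -> i = j.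
Proof. by move=> ij; apply/val_inj/ffunP. Qed.

Lemma dilateE (i : posvec d) l j : dilate i p l j = i j * p j ^ l.
Proof. by rewrite ffunE. Qed.

Lemma dilate0 (i : posvec d) : dilate i p 0 = i.
Proof. by apply: posvecP => j; rewrite dilateE muln1. Qed.

Lemma dilateD (i : posvec d) k l : dilate (dilate i p k) p l = dilate i p (k + l).
Proof. by apply: posvecP => j; rewrite !dilateE expnD mulnA. Qed.

Lemma dilate_inj l : injective (fun i : posvec d => dilate i p l).
Proof.
move=> i j /= ij; apply: posvecP => k.
have /(congr1 (fun v : posvec d => v k)) := ij; rewrite !dilateE => /eqP.
by rewrite eqn_pmul2r ?expn_gt0 ?posvec_gt0// => /eqP.
Qed.

Lemma ltn_dilate (i : posvec d) l j : l < dilate i p l j.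
Proof.
rewrite dilateE; apply: leq_trans (leq_pmull _ (posvec_gt0 i j)).
by rewrite ltn_expl.
Qed.

Lemma leq_dilate (i : posvec d) k l j : k <= l -> dilate i p k j <= dilate i p l j.
Proof. by move=> kl; rewrite !dilateE leq_mul// leq_exp2l. Qed.

Lemma Omega_shift k x : Omega x -> Omega (fun n => x (k + n)).
Proof.
elim: k => [//|k IH] /IH Ox.
suff: [set seq_shift y | y in Omega] (fun n => x (k.+1 + n)) by rewrite shiftOmega.
by exists (fun n => x (k + n)) => //; apply/funext => n; rewrite /seq_shift addnS.
Qed.

(** Surjectivity of the shift on [Omega] supplies the preceding symbols one at a time. *)
Lemma Omega_unshift k x : Omega x -> exists2 y, Omega y & forall n, y (k + n) = x n.
Proof.
move=> Ox; elim: k => [|k [y Oy yx]]; first by exists x.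
have [z Oz zy] : [set seq_shift z | z in Omega] y by rewrite shiftOmega.
by exists z => // n; rewrite addSn -yx -zy.
Qed.

(** [v i] is the largest [l] such that every [p j ^ l] divides [i j], that is, the position of [i]
    on its chain. A sequence [x] in [Omega] then gives the configuration [x (v i)] in [X]. *)
Lemma valuation_exists : exists v : posvec d -> nat, forall i l, v (dilate i p l) = v i + l.
Proof.
pose j0 := Ordinal d_gt0.
pose P (i : posvec d) l := [forall j, p j ^ l %| i j].
have P0 i : exists l, P i l by exists 0; apply/forallP => j; rewrite dvd1n.
have Pub i l : P i l -> l <= i j0.
  move=> /forallP /(_ j0) /(dvdn_leq (posvec_gt0 i j0)).
  by apply: leq_trans; rewrite ltnW// ltn_expl.
exists (fun i => ex_maxn (P0 i) (Pub i)) => i l.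
case: ex_maxnP => a Pa amax; case: ex_maxnP => b Pb bmax.
have Pl c : P (dilate i p l) (c + l) = P i c.
  apply: eq_forallb => j.
  by rewrite dilateE expnD dvdn_pmul2r// expn_gt0 posvec_gt0.
have le_ba : b + l <= a by apply: amax; rewrite Pl.
apply/eqP; rewrite eqn_leq le_ba andbT.
have la : l <= a by apply: leq_trans le_ba; rewrite leq_addl.
by rewrite addnC -leq_subLR bmax// -Pl subnK.
Qed.

Definition fset_restrict (F : {fset posvec d}) (x : posvec d -> 'I_r) : {ffun F -> 'I_r} :=
  [ffun i => x (val i)].

Lemma patternsE F : patterns F X = fin_image X (fset_restrict F).
Proof.
apply/setP => w; rewrite !inE; apply: asbool_equiv_eq; split => -[x Xx wx]; exists x => //.
  by apply/ffunP => i; rewrite ffunE wx.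
by move=> i; rewrite -wx ffunE.
Qed.

Lemma fset_restrictP F (x y : posvec d -> 'I_r) :
  fset_restrict F x = fset_restrict F y <-> {in F, x =1 y}.
Proof.
split=> [/ffunP xy i Fi | xy]; first by move: (xy (FSetSub Fi)); rewrite !ffunE.
by apply/ffunP => i; rewrite !ffunE; apply: xy; exact: fsvalP.
Qed.

(** [C] is a union of whole chains and [mis] constrains each chain separately, so one configuration
    on [C] can be spliced with another off [C]. *)
Lemma card_patternsU (C : set (posvec d)) F1 F2 :
  (forall i, C (dilate i p 1) <-> C i) ->
  (forall i, i \in F1 -> C i) -> (forall i, i \in F2 -> ~ C i) ->
  #|patterns (F1 `|` F2) X| = #|patterns F1 X| * #|patterns F2 X|.
Proof.
move=> Csat F1C F2C; rewrite !patternsE.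
rewrite -card_fin_image_pair.
  apply: eq_card_fin_image => x y _ _; rewrite fset_restrictP; split=> [xy | ].
    by congr pair; apply/fset_restrictP => i iF; apply: xy; rewrite inE iF ?orbT.
  case=> /fset_restrictP xy1 /fset_restrictP xy2 i; rewrite inE => /orP[]; [exact: xy1|exact: xy2].
move=> x y Xx Xy; exists (fun i => if `[< C i >] then x i else y i).
  have Cdil i l : `[< C (dilate i p l) >] = `[< C i >].
    elim: l => [|l IH]; first by rewrite dilate0.
    by rewrite -IH -addn1 -dilateD; apply: asbool_equiv_eq; exact: Csat.
  move=> i; have [Ci|Ci] := asboolP (C i).
    by rewrite (_ : (fun l => _) = (fun l => x (dilate i p l)))//;
       apply/funext => l; rewrite Cdil asboolT.
  by rewrite (_ : (fun l => _) = (fun l => y (dilate i p l)))//;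
       apply/funext => l; rewrite Cdil asboolF.
split; apply/fset_restrictP => i iF.
  by rewrite asboolT//; exact: F1C.
by rewrite asboolF//; exact: F2C.
Qed.

Definition segment (i : posvec d) k : {fset posvec d} :=
  [fset dilate i p l | l in iota 0 k].

Lemma segmentP i k j :
  reflect (exists2 l, l < k & j = dilate i p l) (j \in segment i k).
Proof.
apply: (iffP (imfsetP _ _ _ _)) => -[l /=].
  by rewrite mem_iota /= => lk ->; exists l.
by move=> lk ->; exists l; rewrite //= mem_iota.
Qed.

Lemma card_patterns_segment i k : #|patterns (segment i k) X| = #|blocks Omega k|.
Proof.
rewrite patternsE.
rewrite (@eq_card_fin_image _ _ _ _ _ (fun x => [tuple x (dilate i p l) | l < k])).
  congr #|pred_of_set _|; apply/setP => w; rewrite !inE; apply: asbool_equiv_eq; split.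
    move=> [x Xx <-]; exists (fun l => x (dilate i p l)); first exact: Xx.
    by exists 0 => l; rewrite tnth_mktuple.
  move=> [x Ox [a xw]]; have [v vdil] := valuation_exists.
  (* The point [i] sits at position [v i] of its chain, so the tail of [x] from [a] on has to be
     extended by [v i] symbols to the left. *)
  have [y Oy yx] := Omega_unshift (v i) (Omega_shift a Ox).
  exists (fun j => y (v j)).
    by move=> j; under eq_fun do rewrite vdil; exact: Omega_shift.
  by apply: eq_from_tnth => l; rewrite tnth_mktuple vdil yx xw.
move=> x y _ _; rewrite fset_restrictP; split=> [xy|xy j].
  by apply: eq_from_tnth => l; rewrite !tnth_mktuple xy//; apply/segmentP; exists l.
case/segmentP => l lk ->.
by have := congr1 (fun t => tnth t (Ordinal lk)) xy; rewrite !tnth_mktuple.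
Qed.

End Patterns.

(** * Sizes of boxes and of their differences *)

Section Box.
Local Open Scope fset_scope.
Local Open Scope nat_scope.

Lemma card_box d (n : 'I_d -> nat) : #|` box n| = \prod_j n j.
Proof.
pose N := \max_j n j.
pose g (i : box n) : {ffun 'I_d -> 'I_N.+1} := [ffun j => inord (val i j)].
pose A j := [pred x : 'I_N.+1 | 0 < x <= n j].
have val_le (i : box n) j : val i j <= n j.
  by have := fsvalP i; rewrite in_box => /forallP.
have gE i j : g i j = val i j :> nat.
  by rewrite ffunE inordK// ltnS (leq_trans (val_le i j))// leq_bigmax.
have g_inj : injective g.
  by move=> x y gxy; apply/val_inj/posvecP => j; rewrite -!gE gxy.
rewrite cardfE -(card_imset _ g_inj) (_ : [set g x | x in _]%SET = [set u in family A]%SET).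
  rewrite cardsE card_family foldrE big_map /=.
  rewrite big_enum; apply: eq_bigr => j _.
  rewrite -sum1_card (eq_bigl (fun x : 'I_N.+1 => 0 < x <= n j))//.
  have nN : n j <= N by exact: leq_bigmax.
  rewrite -(big_mkord (fun x => 0 < x <= n j) (fun=> 1)) big_ltn_cond//=.
  rewrite (big_cat_nat (n := (n j).+1))//= [X in _ + X]big1_seq ?addn0; last first.
    by move=> x /andP[/andP[_ xn]]; rewrite mem_index_iota ltnNge xn.
  rewrite big_seq_cond (eq_bigl (fun x => x \in index_iota 1 (n j).+1)).
    by rewrite -big_seq sum_nat_const_nat muln1 subn1.
  by move=> x; rewrite mem_index_iota ltnS andbb.
apply/setP => u; rewrite !inE; apply/imsetP/familyP => [[i _ ->] j|uA].
  by rewrite inE gE posvec_gt0 val_le.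
have upos : [forall j, 0 < [ffun j => nat_of_ord (u j)] j].
  by apply/forallP => j; rewrite ffunE; have /andP[] := uA j.
have ubox : Posvec upos \in box n.
  by rewrite in_box; apply/forallP => j; rewrite ffunE; have /andP[] := uA j.
exists (FSetSub ubox) => //; apply/ffunP => j; apply: val_inj.
by rewrite /= gE /= ffunE.
Qed.

Lemma box_minn d (n n' : 'I_d -> nat) :
  box n `&` box n' = box (fun j => minn (n j) (n' j)).
Proof.
apply/fsetP => i; rewrite inE !in_box; apply/andP/forallP => [[/forallP n1 /forallP n2] j|n12].
  by rewrite leq_min n1 n2.
by split; apply/forallP => j; have := n12 j; rewrite leq_min => /andP[].
Qed.

(** The second box need not lie in the first, hence the minimum; the additive form avoids truncated
    subtraction. *)
Lemma card_boxD d (n n' : 'I_d -> nat) :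
  \prod_j minn (n j) (n' j) + #|` box n `\` box n'| = \prod_j n j.
Proof. by rewrite -!card_box -box_minn cardfsID. Qed.

(** [i j * p j ^ l <= m j] amounts to [i j <= m j %/ p j ^ l], and it already forces [i] into the
    box of [m]. *)
Lemma boundary_dilate d (p : posvec d) (f : 'I_d -> nat -> nat) m l :
  [fset i in boundary f m | dilate i p l \in box m] =
  box (fun j => m j %/ p j ^ l) `\` box (fun j => f j (m j)).
Proof.
have mE i : (i \in box (fun j => m j %/ p j ^ l)) = (dilate i p l \in box m).
  rewrite !in_box; apply: eq_forallb => j.
  by rewrite dilateE leq_divRL// expn_gt0 posvec_gt0.
apply/fsetP => i; rewrite !inE /= mE -andbA; congr andb; apply: andb_idl.
rewrite !in_box => /forallP pm; apply/forallP => j; apply: leq_trans (pm j).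
by rewrite dilateE leq_pmulr// expn_gt0 posvec_gt0.
Qed.

End Box.

(** * The logarithm of the pattern count as a weighted sum *)

Section Count.
Variables (d r : nat) (p : posvec d) (Omega : set (nat -> 'I_r)).
Hypotheses (d_gt0 : (0 < d)%N) (p_ge2 : forall j, (2 <= p j)%N).
Hypothesis Omega0 : Omega !=set0.
Hypothesis shiftOmega : @seq_shift 'I_r @` Omega = Omega.

Local Notation X := (mis p Omega).
Local Open Scope fset_scope.

(** The chain of [i] meets [F] in a segment of [k] points starting at [i]. Deleting [i] shortens
    this segment by one and leaves the other chains alone. The product form avoids a division. *)
Lemma card_patternsD1 F i k :
  (forall l, (dilate i p l \in F) = (l < k)%N) ->
  (forall j l, j \in F -> i = dilate j p l -> j = i) ->
  (0 < k)%N ->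
  (#|patterns F X| * #|blocks Omega k.-1| =
   #|patterns (F `\ i) X| * #|blocks Omega k|)%N.
Proof.
case: k => //= k Fi minF _.
(* The whole chain of [i], including the points preceding [i]. *)
pose C j := exists a b, dilate j p a = dilate i p b.
have Csat j : C (dilate j p 1) <-> C j.
  split=> -[a [b ab]].
    by exists (1 + a)%N, b; rewrite -dilateD.
  by exists a, (b + 1)%N; rewrite dilateD addnC -!dilateD ab dilateD.
have segC l k' j : j \in segment p (dilate i p l) k' -> C j.
  by case/segmentP => b _ ->; exists 0%N, (l + b)%N; rewrite dilate0 dilateD.
have FC j : j \in F `\` segment p i k.+1 -> ~ C j.
  rewrite !inE => /andP[jseg jF] [a [b ab]]; case/negP: jseg; apply/segmentP.
  (* A point of [F] on the chain of [i] either follows [i], and lies in the segment by [Fi], or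
     precedes it, and is then [i] itself by [minF]. *)
  have [le_ab|lt_ba] := leqP a b.
    have ji : j = dilate i p (b - a).
      by apply: (@dilate_inj _ p a); rewrite dilateD subnK.
    by exists (b - a)%N => //; rewrite -Fi -ji.
  have ij : i = dilate j p (a - b).
    by apply: (@dilate_inj _ p b); rewrite dilateD subnK// ltnW.
  by exists 0%N; rewrite // dilate0; exact: minF ij.
have FE : F = segment p i k.+1 `|` (F `\` segment p i k.+1).
  apply/fsetP => j; rewrite !inE; have [|//] := boolP (j \in segment _ _ _).
  by case/segmentP => l lk ->; rewrite Fi.
have FDE : F `\ i = segment p (dilate i p 1) k `|` (F `\` segment p i k.+1).
  apply/fsetP => j; rewrite !inE; apply/andP/orP => [[ji jF]|].
    have [/segmentP[[|l] lk jE]|jseg] := boolP (j \in segment p i k.+1); last by right; rewrite jF.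
      by rewrite jE dilate0 eqxx in ji.
    by left; apply/segmentP; exists l; rewrite ?dilateD.
  case=> [/segmentP[l lk ->]|/andP[jseg ->]].
    rewrite dilateD Fi ltnS lk; split=> //; apply/eqP => /(congr1 (fun v : posvec d => v (Ordinal d_gt0))).
    move/eqP; rewrite dilateE -[X in _ == X]muln1 eqn_pmul2l ?posvec_gt0//.
    by rewrite -(expn0 (p (Ordinal d_gt0))) eqn_exp2l.
  split=> //; apply: contra jseg => /eqP ->.
  by apply/segmentP; exists 0%N; rewrite ?dilate0.
pose N F := #|patterns F X|.
have -> : #|patterns F X| = N (segment p i k.+1 `|` (F `\` segment p i k.+1)) by rewrite -FE.
have -> : #|patterns (F `\ i) X| = N (segment p (dilate i p 1) k `|` (F `\` segment p i k.+1)).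
  by rewrite -FDE.
rewrite /N !(card_patternsU Omega (C := C))//; last 2 first.
- by move=> j; exact: segC.
- by move=> j jseg; apply: (segC 0%N k.+1); rewrite dilate0.
rewrite !card_patterns_segment//.
by rewrite mulnC mulnA mulnAC.
Qed.

Lemma blocks_gt0 k : (0 < #|blocks Omega k|)%N.
Proof.
have [x Ox] := Omega0.
apply/card_gt0P; exists [tuple x l | l < k]; rewrite inE; apply/asboolP.
by exists x => //; exists 0%N => l; rewrite tnth_mktuple.
Qed.

Lemma patterns_gt0 F : (0 < #|patterns F X|)%N.
Proof.
have [v vdil] := valuation_exists d_gt0 p_ge2.
have [x Ox] := Omega0; rewrite patternsE.
apply/card_gt0P; exists (fset_restrict F (fun i => x (v i))); rewrite inE; apply/asboolP.
exists (fun i => x (v i)) => // i.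
by under eq_fun do rewrite vdil; exact: (Omega_shift shiftOmega _ Ox).
Qed.

Lemma card_blocks0 : #|blocks Omega 0| = 1%N.
Proof.
apply/eqP; rewrite eqn_leq blocks_gt0 andbT.
by apply: leq_trans (max_card _) _; rewrite card_tuple.
Qed.

Lemma blocksE k : blocks Omega k = fin_image Omega (fun x => [tuple x l | l < k]).
Proof.
apply/setP => w; rewrite !inE; apply: asbool_equiv_eq; split=> -[x Ox].
  move=> [a xw]; exists (fun l => x (a + l)%N); first exact: (Omega_shift shiftOmega a Ox).
  by apply: eq_from_tnth => l; rewrite tnth_mktuple.
by move=> <-; exists x => //; exists 0%N => l; rewrite tnth_mktuple.
Qed.

Lemma card_blocksS k : (#|blocks Omega k| <= #|blocks Omega k.+1| <= #|blocks Omega k| * r)%N.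
Proof.
rewrite !blocksE; apply/andP; split.
  apply: leq_card_fin_image => x y _ _ xy; apply: eq_from_tnth => l; rewrite !tnth_mktuple.
  by move/(congr1 (fun t => tnth t (widen_ord (leqnSn k) l))): xy; rewrite !tnth_mktuple.
apply: leq_trans (_ : #|fin_image Omega (fun x => ([tuple x l | l < k], x k))| <= _)%N.
  apply: leq_card_fin_image => x y _ _ xyE.
  have xy := congr1 fst xyE; have xyk := congr1 snd xyE; rewrite /= in xy xyk.
  apply: eq_from_tnth => l; rewrite !tnth_mktuple.
  have := ltn_ord l; rewrite ltnS leq_eqVlt => /predU1P[->//|lk].
  by move/(congr1 (fun t => tnth t (Ordinal lk))): xy; rewrite !tnth_mktuple.
rewrite -[X in (_ * X)%N]card_ord -cardsT -cardsX; apply/subset_leq_card/fintype.subsetP => -[w c].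
rewrite !inE andbT => -[x Ox wE]; apply/asboolP; exists x => //.
exact: (congr1 fst wE).
Qed.

Variable R : realType.

Let L k : R := ln #|blocks Omega k|%:R.

(** This is [D k] of the introduction, and [entropy_incr2] is [e]. As [0.-1 = 0], [D] vanishes at 0,
    so the increments telescope from there. *)
Definition entropy_incr k : R := L k - L k.-1.

Definition entropy_incr2 k : R := entropy_incr k.+1 - entropy_incr k.

Lemma entropy_incr_sum k : \sum_(l < k) entropy_incr2 l = entropy_incr k.
Proof.
elim: k => [|k IH]; first by rewrite big_ord0 /entropy_incr subrr.
by rewrite big_ord_recr /= IH addrC subrK.
Qed.

Lemma entropy_incr_bound k : 0 <= entropy_incr k <= ln r%:R.
Proof.
have [x _] := Omega0.
have r_gt0 : (0 < r)%N by case: (r) (x 0%N) => // -[].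
have lnr0 : 0 <= ln (r%:R : R) by rewrite ln_ge0// ler1n.
case: k => [|k]; first by rewrite /entropy_incr subrr lexx.
have /andP[kS Sk] := card_blocksS k.
have b_pos n : #|blocks Omega n|%:R \is @Num.pos R by rewrite posrE ltr0n blocks_gt0.
rewrite /entropy_incr subr_ge0 /L ler_ln// ler_nat kS/= lerBlDl -lnM ?posrE ?ltr0n ?blocks_gt0//.
by rewrite ler_ln ?posrE ?mulr_gt0 ?ltr0n ?blocks_gt0// -natrM ler_nat.
Qed.

Lemma entropy_incr2_bound k : `|entropy_incr2 k| <= ln r%:R.
Proof.
have /andP[k0 kr] := entropy_incr_bound k; have /andP[Sk0 Skr] := entropy_incr_bound k.+1.
rewrite /entropy_incr2 ler_norml; apply/andP; split; lra.
Qed.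

Lemma entropy_incr2_0 : entropy_incr2 0 = ln #|blocks Omega 1|%:R.
Proof. by rewrite /entropy_incr2 /entropy_incr subrr subr0 /L card_blocks0 ln1 subr0. Qed.

(** Points are deleted one at a time, each being the first point [i] of [F] on its chain. Upward
    closure of [F] makes the rest of that chain a segment of some length [k], so the logarithm drops
    by the sum of [e l] over [l < k], and these are the indices at which [i] is counted on the
    right. *)
Lemma ln_card_patterns m K F :
  F `<=` box m -> (forall j, (m j <= K)%N) ->
  (forall i, i \in F -> dilate i p 1 \in box m -> dilate i p 1 \in F) ->
  ln #|patterns F X|%:R =
  \sum_(l < K) entropy_incr2 l * #|` [fset i in F | dilate i p l \in box m]|%:R.
Proof.
move=> + mK; move En : #|` F| => n.
elim: n F En => [|n IH] F Fn Fm Fup.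
  rewrite big1 => [|l _]; last first.
    rewrite (_ : [fset _ in F | _] = fset0) ?cardfs0 ?mulr0//.
    by apply/fsetP => i; rewrite (cardfs0_eq Fn) !inE.
  suff -> : #|patterns F X| = 1%N by rewrite ln1.
  apply/eqP; rewrite eqn_leq patterns_gt0 andbT (leq_trans (max_card _))//.
  by rewrite card_ffun -cardfE Fn.
pose j0 := Ordinal d_gt0.
(* Proper dilation increases every coordinate, so a point with least coordinate [j0] has no
   predecessor in [F]. *)
have [i Fi imin] : exists2 i, i \in F & forall j, j \in F -> (i j0 <= j j0)%N.
  have /fset0Pn[i0 Fi0] : F != fset0 by rewrite -cardfs_gt0 Fn.
  have ex0 : exists a, `[< exists2 i, i \in F & i j0 = a >].
    by exists (i0 j0); apply/asboolP; exists i0.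
  case: (ex_minnP ex0) => a /asboolP[i Fi <-] amin; exists i => // j Fj.
  by apply: amin; apply/asboolP; exists j.
have box_dil l l' : (l <= l')%N -> dilate i p l' \in box m -> dilate i p l \in box m.
  rewrite !in_box => ll' /forallP il'; apply/forallP => j.
  by apply: leq_trans (il' j); rewrite leq_dilate.
have exk : exists l, dilate i p l \notin box m.
  exists (m j0); rewrite in_box; apply/forallPn; exists j0.
  by rewrite -ltnNge ltn_dilate.
case: (ex_minnP exk) => k kbox kmin.
have boxE l : (dilate i p l \in box m) = (l < k)%N.
  rewrite ltnNge; apply/idP/idP => [lm|]; first by apply: contra kbox => /box_dil; apply.
  by apply: contraNT => /kmin.
have FE l : (dilate i p l \in F) = (l < k)%N.
  apply/idP/idP => [/(fsubsetP Fm)|]; first by rewrite boxE.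
  elim: l => [|l IHl] lk; first by rewrite dilate0.
  rewrite -addn1 -dilateD; apply: Fup; first by rewrite IHl// ltnW.
  by rewrite dilateD addn1 boxE.
have minF j l : j \in F -> i = dilate j p l -> j = i.
  case: l => [_ ->|l jF ij]; first by rewrite dilate0.
  have := imin j jF; rewrite ij leqNgt dilateE => /negP[].
  by rewrite -[ltnLHS]muln1 ltn_pmul2l ?posvec_gt0// -(expn0 (p j0)) ltn_exp2l.
have k_gt0 : (0 < k)%N by rewrite -FE dilate0.
have kK : (k <= K)%N.
  apply: leq_trans (mK j0); apply: kmin; rewrite in_box; apply/forallPn; exists j0.
  by rewrite -ltnNge ltn_dilate.
have FDn : #|` F `\ i| = n by move: Fn; rewrite (cardfsD1 i) Fi => -[].
have /(congr1 (fun a => ln (a%:R : R))) := card_patternsD1 FE minF k_gt0.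
rewrite !natrM !lnM ?posrE ?ltr0n ?blocks_gt0 ?patterns_gt0// => /(canRL (addrK _)) ->.
rewrite IH//; last 2 first.
- by apply: fsubset_trans Fm; rewrite fsubD1set.
- move=> j; rewrite !inE => /andP[ji jF] jm; rewrite Fup// andbT.
  apply: contra ji => /eqP ji; apply/eqP; apply: (minF j 1%N) => //.
rewrite -addrA -/(entropy_incr k) -entropy_incr_sum.
rewrite (big_ord_widen K (fun l => entropy_incr2 l))// [X in (_ + X)%R]big_mkcond -big_split/=.
apply: eq_bigr => l _; rewrite [in RHS](cardfsD1 i) natrD mulrDr addrC; congr (_ + _)%R.
  by rewrite !inE /= Fi boxE; case: ifP; rewrite ?mulr1 ?mulr0.
congr (_ * _%:R)%R; congr #|` _|; apply/fsetP => j; rewrite !inE /=.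
by rewrite andbA.
Qed.

End Count.

(** * Dominated convergence for series *)

Section Series.
Variable R : realType.

Lemma dist_lim_series_le (u M : R^nat) N :
  (forall n, `|u n| <= M n) -> cvgn (series M) ->
  `|limn (series u) - series u N| <= limn (series M) - series M N.
Proof.
move=> uM cM.
have cu : cvgn (series u).
  apply: normed_cvg; apply: (series_le_cvg _ _ uM cM) => n //=.
  exact: le_trans (normr_ge0 _) (uM n).
have lu : `|series u n - series u N| @[n --> \oo] --> `|limn (series u) - series u N|.
  by apply: cvg_norm; apply: cvgB => //; exact: cvg_cst.
have lM : (series M n - series M N) @[n --> \oo] --> limn (series M) - series M N.
  by apply: cvgB => //; exact: cvg_cst.
apply: ler_cvg_to lu lM _; near=> n.
have Nn : (N <= n)%N by near: n; exact: nbhs_infty_ge.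
rewrite !sub_series_geq//; apply: le_trans (ler_norm_sum _ _ _) _.
by apply: ler_sum => k _.
Unshelve. all: by end_near. Qed.

(** The majorant bounds both tails by [e / 3], uniformly in [x], and the finitely many remaining
    terms converge one by one. *)
Lemma tannery (T : Type) (F : set_system T) {FF : ProperFilter F}
    (a : T -> R^nat) (b M : R^nat) :
  (forall x n, `|a x n| <= M n) -> cvgn (series M) ->
  (forall n, a x n @[x --> F] --> b n) ->
  limn (series (a x)) @[x --> F] --> limn (series b).
Proof.
move=> aM cM ab.
have bM n : `|b n| <= M n.
  apply: (@closed_cvg _ _ F FF (fun x => `|a x n|) [set y | y <= M n]).
  - exact: closed_le.
  - by apply: nearW => x; exact: aM.
  - exact: cvg_norm.
apply/cvgrPdist_le => e e0.
have e3 : 0 < e / 3 by rewrite divr_gt0.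
have [N tailN] : exists N, limn (series M) - series M N <= e / 3.
  have /cvgrPdist_le/(_ _ e3) : series M @ \oo --> limn (series M) by [].
  by move=> [N _ /(_ N (leqnn N)) /= HN]; exists N; apply: le_trans (ler_norm _) HN.
have /cvgrPdist_le/(_ _ e3) : series (a x) N @[x --> F] --> series b N.
  rewrite /series /=; apply: cvg_big => //; exact: add_continuous.
apply: filterS => x abN.
have := dist_lim_series_le N bM cM; have := dist_lim_series_le N (aM x) cM.
move: abN tailN; rewrite !ler_norml => /andP[? ?] ? /andP[? ?] /andP[? ?].
apply/andP; split; lra.
Qed.

End Series.

(** * Densities of boxes with rounded sides *)

Section Density.
Variables (R : realType) (d : nat).
Implicit Types (x y : 'I_d -> R) (m : 'I_d -> nat).

Lemma near_to_infty_ge (N : nat) : \forall m \near to_infty d, forall j, (N <= m j)%N.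
Proof. by exists N. Qed.

Definition box_density x m : R :=
  (\prod_j Num.truncn (x j * (m j)%:R))%:R / (\prod_j m j)%:R.

Lemma box_densityE x m :
  box_density x m = \prod_j ((Num.truncn (x j * (m j)%:R))%:R / (m j)%:R).
Proof. by rewrite /box_density !natr_prod -prodf_div. Qed.

Lemma cvg_box_density x : (forall j, 0 <= x j) ->
  box_density x @ to_infty d --> \prod_j x j.
Proof.
move=> x0; rewrite (funext (box_densityE x)).
apply: cvg_big => [|j _]; first exact: mul_continuous.
apply/cvgrPdist_le => e e0.
near=> m.
(* Rounding costs less than 1, hence at most [(m j)^-1 <= e] after the division. *)
have [m1 me] : (0 < m j)%N /\ e^-1 <= (m j)%:R.
  split; last apply: le_trans (ltW (truncnS_gt e^-1)) _; rewrite ?ler_nat; move: j; near: m;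
  exact: near_to_infty_ge.
have m0 : 0 < (m j)%:R :> R by rewrite ltr0n.
have xm0 : 0 <= x j * (m j)%:R by rewrite mulr_ge0.
have /andP[le_t lt_t] := truncn_itv xm0.
have em : 1 <= e * (m j)%:R by rewrite -ler_pdivrMl// mulr1.
rewrite -{1}[x j](mulfK (lt0r_neq0 m0)) -mulrBl normrM (gtr0_norm (x := _^-1)) ?invr_gt0//.
rewrite ler_pdivrMr// ler_norml; apply/andP; split; first lra.
by move: lt_t; rewrite -natr1; lra.
Unshelve. all: by end_near. Qed.

Lemma box_density_ge0 x m : 0 <= box_density x m.
Proof. by rewrite divr_ge0. Qed.

Lemma box_density_le x y m : (forall j, 0 <= x j <= y j) ->
  box_density x m <= box_density y m.
Proof.
move=> xy; rewrite ler_wpM2r ?invr_ge0// ler_nat leq_prod// => j _.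
by apply/le_truncn/ler_wpM2r => //; have /andP[] := xy j.
Qed.

Lemma box_density_le_prod x m : (forall j, 0 <= x j) -> box_density x m <= \prod_j x j.
Proof.
move=> x0; rewrite box_densityE; apply: ler_prod => j _; rewrite divr_ge0//=.
(* The domination in [tannery] must hold for every [m], including those with [m j = 0], where the
   quotient is 0 by convention. *)
have [->|m0] := posnP (m j); first by rewrite invr0 mulr0.
by rewrite ler_pdivrMr ?ltr0n// truncn_le mulr_ge0.
Qed.

End Density.

(** * The limits as functions of the cut ratio *)

Section Interpolation.
Variables (R : realType) (d r : nat) (p : posvec d) (Omega : set (nat -> 'I_r)).
Hypotheses (d_gt0 : (0 < d)%N) (p_ge2 : forall j, (2 <= p j)%N).
Hypothesis Omega0 : Omega !=set0.
Hypothesis shiftOmega : @seq_shift 'I_r @` Omega = Omega.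

Local Notation X := (mis p Omega).
Local Notation e := (entropy_incr2 Omega R).

Definition cut (t : R) (j : 'I_d) (n : nat) : nat := Num.truncn (t * n%:R).

Let scale l (j : 'I_d) : R := ((p j)%:R ^+ l)^-1.

(* [`|t|] rather than [t]: the summands of [limit_sum] are then bounded for every
   real [t], which makes [limit_sum] continuous on the whole line. *)
Let scale_cap l (t : R) j : R := Num.min (scale l j) `|t|.

Let scale_ge0 l j : 0 <= scale l j.
Proof. by rewrite invr_ge0 exprn_ge0. Qed.

Let scale_cap_bound l t j : 0 <= scale_cap l t j <= scale l j.
Proof. by rewrite le_min scale_ge0 normr_ge0/= ge_min lexx. Qed.

(** One coordinate contributes at most [2^-1 ^+ l] because [p j >= 2], the others at most 1. This is
    the source of the geometric majorant. *)
Let prod_scale_bound l : \prod_j scale l j <= 2^-1 ^+ l.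
Proof.
have p_pos j : 0 < (p j)%:R :> R by rewrite ltr0n posvec_gt0.
have bound j : 0 <= scale l j <= if j == Ordinal d_gt0 then 2^-1 ^+ l else 1.
  rewrite scale_ge0/=; case: ifP => _.
    by rewrite exprVn lef_pV2 ?posrE ?exprn_gt0// lerXn2r ?nnegrE// ler_nat.
  by rewrite invf_le1 ?exprn_gt0// exprn_ege1// ler1n posvec_gt0.
rewrite [leRHS](_ : _ = \prod_(j < d) if j == Ordinal d_gt0 then 2^-1 ^+ l else 1).
  by apply: ler_prod => j _; exact: bound.
by rewrite -big_mkcond big_pred1_eq.
Qed.

(** For [0 <= t <= 1], the limit density of the points of the boundary whose [l]-th dilate is still
    in the box; index 0 gives [b t]. *)
Definition tail_mass (t : R) l : R := \prod_j scale l j - \prod_j scale_cap l t j.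

Definition limit_sum (t : R) : R := limn (series (fun l => e l * tail_mass t l)).

Let majorant l : R := ln r%:R * 2^-1 ^+ l.

Let majorant_cvg : cvgn (series majorant).
Proof. by apply: is_cvg_geometric_series; rewrite ger0_norm; lra. Qed.

(** Arbitrary [x] and [y] let this cover both the densities at a given [m] and their limits. *)
Let term_bound l (x y : R) : 0 <= y -> y <= x -> x <= \prod_j scale l j ->
  `|e l * (x - y)| <= majorant l.
Proof.
move=> y0 yx xs; rewrite normrM ler_pM ?entropy_incr2_bound//.
by rewrite ger0_norm ?subr_ge0//; have := prod_scale_bound l; lra.
Qed.

Let prod_cap_bound l t : 0 <= \prod_j scale_cap l t j <= \prod_j scale l j.
Proof.
apply/andP; split; last by apply: ler_prod => j _; exact: scale_cap_bound.
by apply: prodr_ge0 => j _; have /andP[] := scale_cap_bound l t j.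
Qed.

Lemma continuous_tail_mass l : continuous (tail_mass ^~ l).
Proof.
move=> t; apply: cvgB; first exact: cvg_cst.
apply: cvg_big => [|j _]; first exact: mul_continuous.
(* Expressing the minimum by absolute values reduces continuity to that of the norm. *)
under eq_fun do rewrite /scale_cap minr_absE.
rewrite /scale_cap minr_absE.
apply: cvgMl; apply: cvgB.
  by apply: cvgD; [exact: cvg_cst|exact: cvg_norm].
by apply: cvg_norm; apply: cvgB; [exact: cvg_cst|exact: cvg_norm].
Qed.

Lemma continuous_limit_sum : continuous limit_sum.
Proof.
move=> t; apply: (tannery (F := nbhs t) (M := majorant)) => // [u l|l].
  by have /andP[? ?] := prod_cap_bound l u; exact: term_bound.
by apply: cvgM; [exact: cvg_cst|exact: continuous_tail_mass].
Qed.

(** * Limits for a fixed cut ratio *)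

Section Count.
Variable t : R.
Hypothesis t01 : 0 <= t <= 1.

Let t_ge0 : 0 <= t. Proof. by case/andP: t01. Qed.

Let minn_truncn (x y : R) : minn (Num.truncn x) (Num.truncn y) = Num.truncn (Num.min x y).
Proof.
case: (leP x y) => xy; first by apply/minn_idPl; exact: le_truncn.
by apply/minn_idPr; apply: le_truncn; exact: ltW.
Qed.

Let divn_truncn (m : 'I_d -> nat) l j :
  (m j %/ p j ^ l)%N = Num.truncn (scale l j * (m j)%:R).
Proof.
apply/esym/truncn_def; rewrite mulrC /scale -natrX.
have q0 : (0 < p j ^ l)%N by rewrite expn_gt0 posvec_gt0.
by rewrite ler_pdivlMr ?ltr_pdivrMr ?ltr0n// -!natrM ler_nat ltr_nat leq_divM ltn_ceil.
Qed.

(** The identity is exact for each [m]: [m j %/ p j ^ l] is the floor of a real multiple of [m j],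
    and floors commute with minima. *)
Let tail_count (m : 'I_d -> nat) l :
  #|` [fset i in boundary (cut t) m | dilate i p l \in box m]%fset|%:R / (\prod_j m j)%:R =
  box_density (scale l) m - box_density (scale_cap l t) m.
Proof.
rewrite boundary_dilate /box_density -mulrBl; congr (_ / _).
have := card_boxD (fun j => m j %/ p j ^ l)%N (fun j => cut t j (m j)).
move=> /(congr1 (fun n => n%:R : R)); rewrite natrD => /(canRL (addKr _)) ->.
rewrite addrC; congr (_ %:R - _%:R); apply: eq_bigr => j _; rewrite divn_truncn//.
by rewrite minn_truncn /scale_cap ger0_norm// minr_pMl.
Qed.

Lemma cvg_tail_count l :
  #|` [fset i in boundary (cut t) m | dilate i p l \in box m]%fset|%:R / (\prod_j m j)%:R
    @[m --> to_infty d] --> tail_mass t l.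
Proof.
under eq_fun do rewrite tail_count.
apply: cvgB; apply: cvg_box_density => j; first exact: scale_ge0.
by have /andP[] := scale_cap_bound l t j.
Qed.

Lemma cvg_ln_patterns :
  ln #|patterns (boundary (cut t) m) X|%:R / (\prod_j m j)%:R
    @[m --> to_infty d] --> limit_sum t.
Proof.
pose a m l := e l * (box_density (scale l) m - box_density (scale_cap l t) m).
(* For fixed [m], [ln_card_patterns] holds with any [K] from [\max_j m j] on, so the partial sums
   are eventually constant and equal to the quotient. *)
rewrite (_ : (fun m => _) = fun m => limn (series (a m))); last first.
  apply/funext => m; apply/esym/lim_near_cst => //.
  exists (\max_j m j)%N => // n /= mn.
  rewrite (@ln_card_patterns _ _ p Omega _ _ _ _ R m n)//.
  - rewrite mulr_suml /series /= big_mkord; apply: eq_bigr => l _.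
    by rewrite -mulrA tail_count.
  - exact: fsubsetDl.
  - by move=> j; apply: leq_trans mn; exact: leq_bigmax.
  (* If the dilate of [i] lies in the removed box, so does [i]; the contrapositive is the upward
     closure. *)
  - move=> i; rewrite !inE => /andP[+ _] ->; rewrite andbT; apply: contra.
    rewrite !in_box => /forallP pm; apply/forallP => j; apply: leq_trans (pm j).
    by rewrite dilateE leq_pmulr// expn_gt0 posvec_gt0.
apply: (tannery (F := to_infty d) (M := majorant)) => // [m l|l].
  apply: term_bound; first exact: box_density_ge0.
    by apply: box_density_le => j; exact: scale_cap_bound.
  exact: box_density_le_prod.
apply: cvgM; first exact: cvg_cst.
under eq_fun do rewrite -tail_count; exact: cvg_tail_count.
Qed.

Lemma cvg_card_boundary :
  (#|` boundary (cut t) m|)%:R / (\prod_j m j)%:R @[m --> to_infty d] --> tail_mass t 0.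
Proof.
apply: cvg_trans (@cvg_tail_count 0%N); apply: near_eq_cvg; apply: nearW => m /=.
congr (#|` _|%:R / _); apply/fsetP => i; rewrite !inE /= dilate0 andb_idr//.
by move=> /andP[].
Qed.

Lemma cvg_boundary_complexity : tail_mass t 0 != 0 ->
  has_boundary_complexity (cut t) X (limit_sum t / tail_mass t 0).
Proof.
move=> mass0.
have prod_gt0 : \forall m \near to_infty d, (0 < \prod_j m j)%N.
  by exists 1%N => // m /= m1; rewrite prodn_gt0.
split.
  have : \forall m \near to_infty d, #|` boundary (cut t) m|%:R / (\prod_j m j)%:R != 0 :> R.
    exact: cvgr_neq0 cvg_card_boundary mass0.
  apply: filterS => m; apply: contra => /eqP ->.
  by rewrite cardfs0 mul0r.
apply: cvg_trans (cvgM cvg_ln_patterns (cvgV mass0 cvg_card_boundary)).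
apply: near_eq_cvg; near=> m.
have m0 : (\prod_j m j)%:R != 0 :> R by rewrite pnatr_eq0 -lt0n; near: m.
by rewrite /= invfM invrK mulrACA mulVf ?mulr1//.
Unshelve. all: by end_near. Qed.

Lemma cut_speed : has_speed (cut t) (\prod_(j < d) t).
Proof. by apply: cvg_box_density. Qed.

End Count.

Let prod_cap0 l : \prod_j scale_cap l 0 j = 0.
Proof.
rewrite (bigD1 (Ordinal d_gt0))//= /scale_cap normr0.
by rewrite (min_idPr _) ?mul0r.
Qed.

Lemma tail_mass00 : tail_mass 0 0 = 1.
Proof.
rewrite /tail_mass prod_cap0 subr0 big1// => j _.
by rewrite /scale expr0 invr1.
Qed.

(** Coordinates start at 1, so at ratio 0 the removed box is empty and the boundary is the whole
    box. *)
Lemma entropy_limit_sum : entropy R X = limit_sum 0.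
Proof.
have t01 : 0 <= (0 : R) <= 1 by rewrite lexx ler01.
apply: cvg_lim => //; apply: cvg_trans (cvg_ln_patterns t01).
apply: near_eq_cvg; apply: nearW => m /=.
rewrite (_ : boundary _ _ = box m)//; apply/fsetP => i; rewrite !inE.
rewrite (_ : i \in box (fun j => cut 0 j (m j)) = false)//.
rewrite in_box; apply/negbTE/forallPn; exists (Ordinal d_gt0).
by rewrite /cut mul0r truncn0 -ltnNge posvec_gt0.
Qed.

(** As [p j >= 2], the cap 1/2 is inactive for [l > 0]: a point outside the half box leaves the box
    at its first dilation, so each chain meets the boundary at most once. *)
Lemma tail_mass_half l : (0 < l)%N -> tail_mass 2^-1 l = 0.
Proof.
move=> l0; apply/eqP; rewrite subr_eq0; apply/eqP/eq_bigr => j _.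
apply/esym/min_idPl; rewrite ger0_norm// /scale lef_pV2 ?posrE ?exprn_gt0 ?ltr0n ?posvec_gt0//.
case: l l0 => // l _; rewrite exprS -[leLHS]mulr1 ler_pM ?ler_nat//.
by rewrite exprn_ege1// ler1n posvec_gt0.
Qed.

Lemma limit_sum_half :
  limit_sum 2^-1 = ln #|blocks Omega 1|%:R * tail_mass 2^-1 0.
Proof.
apply: lim_near_cst => //; exists 1%N => // n /= n1.
rewrite /series /= big_ltn// big_nat big1 => [|l /andP[l0 _]].
  by rewrite addr0 entropy_incr2_0.
by rewrite tail_mass_half// mulr0.
Qed.

Lemma tail_mass0_gt0 t : 0 <= t < 1 -> 0 < tail_mass t 0.
Proof.
move=> /andP[t0 t1]; rewrite subr_gt0 [ltRHS]big1 => [|j _]; last by rewrite /scale expr0 invr1.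
rewrite (eq_bigr (fun=> t)) => [|j _].
  by rewrite prodr_const card_ord exprn_ilt1// -lt0n.
by rewrite /scale_cap /scale expr0 invr1 ger0_norm//; apply/min_idPr/ltW.
Qed.

End Interpolation.

(** * Choice of the cut ratio *)

Theorem theorem2p7 (R : realType) (d r : nat) (p : posvec d)
    (Omega : set (nat -> 'I_r)) (hd : (2 <= d)%N) (hp : forall j, (2 <= p j)%N)
    (hOmega : subshift Omega) (h : R)
    (hh : h \in `[entropy R (mis p Omega), ln (#|blocks Omega 1|%:R : R)]) :
  exists (tau : R) (f : 'I_d -> nat -> nat),
    has_speed f tau /\ has_boundary_complexity f (mis p Omega) h.
Proof.
have d_gt0 : (0 < d)%N by exact: ltnW.
have [nonempty_Omega _ shiftOmega] := hOmega.
pose S := limit_sum p Omega : R -> R; pose b (t : R) := tail_mass p t 0.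
(* Unlike the ratio of [S] to [b], whose denominator vanishes at 1, [phi] is continuous on the whole
   line. *)
pose phi t := S t - h * b t.
have phi_cont : continuous phi.
  move=> t; apply: cvgB; first exact: continuous_limit_sum.
  by apply: cvgM; [exact: cvg_cst|exact: continuous_tail_mass].
move: hh; rewrite in_itv/= (entropy_limit_sum R d_gt0 hp nonempty_Omega shiftOmega) => /andP[h_ge h_le].
have phi0 : phi 0 <= 0 by rewrite /phi /b tail_mass00// mulr1 subr_le0.
have phi_half : 0 <= phi 2^-1.
  rewrite /phi /S limit_sum_half// -mulrBl; apply: mulr_ge0; first by rewrite subr_ge0.
  by apply/ltW/tail_mass0_gt0 => //; apply/andP; split; lra.
have phi_between : Num.min (phi 0) (phi 2^-1) <= 0 <= Num.max (phi 0) (phi 2^-1).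
  by rewrite ge_min phi0 le_max phi_half orbT.
have half_ge0 : 0 <= 2^-1 :> R by rewrite invr_ge0.
have [t] := IVT half_ge0 (continuous_subspaceT phi_cont) phi_between.
rewrite in_itv/= => /andP[t0 t_half] /eqP; rewrite subr_eq0 => /eqP St.
(* Stopping at 1/2 keeps [t] away from 1, so the division by [b t] is legitimate. *)
have bt : 0 < b t by apply: tail_mass0_gt0 => //; apply/andP; split => //; lra.
have t01 : 0 <= t <= 1 by apply/andP; split => //; lra.
exists (\prod_(j < d) t), (cut t); split; first exact: cut_speed.
rewrite (_ : h = S t / b t); last by rewrite St mulfK ?gt_eqF.
by apply: cvg_boundary_complexity; rewrite ?gt_eqF.
Qed.
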